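(* Let $N\geq 1$ be an integer and let $\Gamma \leq \mathrm{Homeo}_{+}(I)$ be a subgroup such that every non-identity element of $\Gamma$ has at most $N$ fixed points in $(0,1)$. Suppose that for any two open intervals $J_1, J_2$ with $\overline{J_1}\subset (0,1)$ and $\overline{J_2}\subset (0,1)$ there exists $g\in \Gamma$ such that $g(J_1)\subset J_2$. Then $\Gamma$ is non-discrete in the $C^0$ metric.
   Context: $I=[0,1]$; $\mathrm{Homeo}_{+}(I)$ is the group of orientation preserving homeomorphisms of $I$. Intervals are understood to be non-empty. For $g\in \mathrm{Homeo}_+(I)$ put $\|g\|_0=\max_{0\leq x\leq 1}|g(x)-x|$. A subgroup $G\leq \mathrm{Homeo}_+(I)$ is $C^0$-discrete (discrete in the $C^0$ metric) if there exists $\epsilon>0$ such that $\|g\|_0>\epsilon$ for all $g\in G\setminus\{1\}$; otherwise it is non-discrete. *)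

(* Defs.v *)
From mathcomp Require Import all_boot all_order all_algebra.
From mathcomp Require Import all_classical all_reals all_analysis.

Set Implicit Arguments.
Unset Strict Implicit.
Unset Printing Implicit Defensive.

Import Order.TTheory GRing.Theory Num.Theory.
Import numFieldNormedType.Exports.

Local Open Scope classical_set_scope.
Local Open Scope ring_scope.

(* The interval [0,1] as a type. As the [set_type] of a subset of [R] it
   carries the topology induced by the inclusion [\val] into [R]. *)
Definition unit_interval (R : realType) := set_type (`[0, 1] : set R).

(* On an interval, a homeomorphism preserves orientation iff it is increasing. *)
Definition homeo_plus (R : realType) : set (unit_interval R -> unit_interval R) :=
  [set g | [/\ continuous g,
     exists2 h : unit_interval R -> unit_interval R,
       continuous h & cancel g h /\ cancel h g &
     {homo g : x y / \val x < \val y}]].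

Record homeo_subgroup (R : realType)
    (G : set (unit_interval R -> unit_interval R)) : Prop := HomeoSubgroup {
  homeo_subgroup_sub : G `<=` @homeo_plus R;
  homeo_subgroup_id : G id;
  homeo_subgroup_comp : forall f g, G f -> G g -> G (f \o g);
  homeo_subgroup_inv : forall f g,
    G f -> cancel f g -> cancel g f -> G g }.

Definition interior_fixed_points (R : realType)
    (g : unit_interval R -> unit_interval R) : set (unit_interval R) :=
  [set x | 0 < \val x < 1 /\ g x = x].

(* The displacements lie in [0,1], so this supremum is a genuine one; it is a
   maximum when [g] is continuous. *)
Definition normC0 (R : realType) (g : unit_interval R -> unit_interval R) : R :=
  sup (range (fun x : unit_interval R => `|\val (g x) - \val x|)).

Definition C0_discrete (R : realType)
    (G : set (unit_interval R -> unit_interval R)) : Prop :=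
  exists2 eps : R, 0 < eps & forall g, G g -> g <> id -> eps < normC0 g.

Definition open_interval (R : realType) (J : set R) : Prop :=
  [/\ open J, is_interval J & J !=set0].

(* Main.v *)
Require Import Defs.
From HB Require Import structures.
From mathcomp Require Import all_boot all_order all_algebra.
From mathcomp Require Import all_classical all_reals all_analysis.
From mathcomp Require Import lra zify.
Import Order.TTheory GRing.Theory Num.Theory.
Import numFieldNormedType.Exports.
Local Open Scope classical_set_scope.
Local Open Scope ring_scope.

(* After identifying (0,1) with the real line, the finiteness of fixed point
   sets makes "g x < h x for all x near -oo" a bi-invariant total order on the
   group.  If b is infinitesimal with respect to u, the conjugates of b by u^l
   shrink as l grows, and some points y are almost fixed by them, together with
   all u^-k y.  Multiplying alternately by such conjugates of a chain of
   elements that stay comparable under this shrinking produces a word that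
   changes direction once more at each step, hence gains a fixed point; this
   bounds the length of such chains and forces a smallest archimedean class to
   exist.  By Hölder's theorem the conjugates of an element a of that class
   commute, so they act freely: fixed points would be shared by all of them and
   fill a whole unbounded orbit of the group.  Hence these conjugates do not
   cross each other, and contracting [p, a p] into small intervals yields
   conjugates of a that move a prescribed finite set of points as little as we
   like; their minimum is C^0-small. *)

Lemma exists_lt_lt (R : realType) (x y : R) : x < y -> exists z, x < z < y.
Proof. by move=> /midf_lt h; exists ((x + y) / 2); rewrite !h. Qed.

(** * Increasing actions on the line with boundedly many fixed points *)

Section LineAction.
Set Implicit Arguments.
Unset Strict Implicit.
Local Open Scope group_scope.

Context (R : realType) (G : groupType) (act : G -> R -> R) (N : nat).
Hypothesis act1 : forall x, act 1 x = x.
Hypothesis actM : forall g h x, act (g * h) x = act g (act h x).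
Hypothesis act_mono : forall g, {homo act g : x y / x < y}.
Hypothesis act_fix : forall g (s : seq R), g <> 1 -> sorted <%R s ->
  (forall x, x \in s -> act g x = x) -> (size s <= N)%N.

Lemma actK g x : act g^-1 (act g x) = x.
Proof. by rewrite -actM mulVg act1. Qed.

Lemma actVK g x : act g (act g^-1 x) = x.
Proof. by rewrite -actM mulgV act1. Qed.

Lemma act_lt g : {mono act g : x y / x < y}.
Proof.
move=> x y; apply/idP/idP; last exact: act_mono.
by move=> /(@act_mono g^-1); rewrite !actK.
Qed.

Lemma act_le g : {mono act g : x y / x <= y}.
Proof. by move=> x y; rewrite !leNgt act_lt. Qed.

Lemma actV_lt g x y : (act g^-1 x < y) = (x < act g y).
Proof. by rewrite -(act_lt g) actVK. Qed.

Lemma lt_actV g x y : (x < act g^-1 y) = (act g x < y).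
Proof. by rewrite -(act_lt g) actVK. Qed.

(** The supremum of the bounded forward orbit is fixed. Continuity is not assumed: an increasing
    bijection commutes with suprema, as [actV_lt] expresses. *)
Lemma orbit_sup g x y : x <= act g x -> (forall n, act (g ^+ n) x <= y) ->
  exists2 s, x <= s <= y & act g s = s.
Proof.
move=> xg ubd.
pose E := range (fun n => act (g ^+ n) x).
have E0 : E !=set0 by exists x; exists 0%N => //; rewrite expg0 act1.
have ubE : has_ubound E by exists y => _ [n _ <-].
have inE' n : act (g ^+ n) x <= sup E by apply: ub_le_sup => //; exists n.
exists (sup E).
  apply/andP; split; first by move: (inE' 0%N); rewrite expg0 act1.
  by apply: ge_sup => // _ [n _ <-].
apply/eqP; rewrite eq_le; apply/andP; split.
  rewrite leNgt -actV_lt; apply/negP => h.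
  have [_ [n _ <-]] := sup_gt E0 h.
  rewrite actV_lt -actM -expgS => h2.
  by move: (inE' n.+1); rewrite leNgt h2.
have xs : x <= sup E by move: (inE' 0%N); rewrite expg0 act1.
apply: ge_sup => // _ [n _ <-]; case: n => [|n].
  by rewrite expg0 act1 (le_trans xg)// act_le.
by rewrite expgS actM act_le.
Qed.

Lemma orbit_escape g x y : (forall s, x <= s <= y -> s < act g s) ->
  exists n, y < act (g ^+ n) x.
Proof.
move=> up; apply: contrapT => nex.
have ubd n : act (g ^+ n) x <= y.
  by rewrite leNgt; apply/negP => h; apply: nex; exists n.
have xy : x <= y by move: (ubd 0%N); rewrite expg0 act1.
have xg : x <= act g x by apply/ltW/up; rewrite lexx.
have [s hs es] := orbit_sup xg ubd.
by move: (up s hs); rewrite es ltxx.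
Qed.

(** An intermediate value argument: the fixed point is the supremum of the points of [x, y] that [g]
    moves down. *)
Lemma crossing g x y : x < y -> act g x < x -> y < act g y ->
  exists2 s, x < s < y & act g s = s.
Proof.
move=> xy gx gy.
pose E := [set z | x <= z <= y /\ act g z < z].
have Ex : E x by split=> //; rewrite lexx ltW.
have E0 : E !=set0 by exists x.
have ubE : has_ubound E by exists y => z [/andP[]].
have xs : x <= sup E by apply: ub_le_sup.
have sy : sup E <= y by apply: ge_sup => // z [/andP[]].
have es : act g (sup E) = sup E.
  apply/eqP; rewrite eq_le; apply/andP; split; rewrite leNgt; apply/negP.
    rewrite -actV_lt => h.
    have [z Ez hz] := sup_gt E0 h.
    have zs := ub_le_sup ubE Ez; move: Ez hz => [_ gz]; rewrite actV_lt => hz.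
    by move: (lt_trans hz gz); rewrite ltNge zs.
  rewrite -lt_actV => h.
  have sy' : sup E < y.
    rewrite lt_neqAle sy andbT; apply/eqP => e.
    by move: h; rewrite lt_actV e => /(lt_trans gy); rewrite ltxx.
  (* Such a [z] satisfies [act g z < sup E < z], so it lies in [E] above its supremum. *)
  have [|z /andP[sz]] := @exists_lt_lt _ (sup E) (Num.min (act g^-1 (sup E)) y).
    by rewrite lt_min h.
  rewrite lt_min => /andP[zg zy].
  have : E z.
    split; first by rewrite (le_trans xs (ltW sz)) ltW.
    by apply: (lt_trans _ sz); rewrite -lt_actV.
  by move=> /(ub_le_sup ubE); rewrite leNgt sz.
exists (sup E) => //; rewrite !lt_neqAle xs sy !andbT; apply/andP; split.
  by apply/eqP => e; move: gx; rewrite e es ltxx.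
by apply/eqP => e; move: gy; rewrite -e es ltxx.
Qed.

Lemma crossing_down g x y : x < y -> x < act g x -> act g y < y ->
  exists2 s, x < s < y & act g s = s.
Proof.
move=> xy gx gy; have [||s hs es] := @crossing g^-1 x y xy.
- by rewrite actV_lt.
- by rewrite lt_actV.
- by exists s => //; rewrite -{1}es actVK.
Qed.

(** * The order of germs at -oo *)

Definition deep (P : R -> Prop) := exists z, forall x, x < z -> P x.

Lemma deepI P Q : deep P -> deep Q -> deep (fun x => P x /\ Q x).
Proof.
move=> [z hz] [t ht]; exists (Num.min z t) => x.
by rewrite lt_min => /andP[/hz Px /ht].
Qed.

Lemma deepW P Q : (forall x, P x -> Q x) -> deep P -> deep Q.
Proof. by move=> PQ [z hz]; exists z => x /hz /PQ. Qed.

Lemma deep_act g P : deep P -> deep (fun x => P (act g x)).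
Proof.
by move=> [z hz]; exists (act g^-1 z) => x; rewrite lt_actV => /hz.
Qed.

Lemma deep_ex P : deep P -> exists x, P x.
Proof. by move=> [z hz]; exists (z - 1)%R; apply: hz; lra. Qed.

Lemma deep_lt y : deep (fun x => x < y).
Proof. by exists y. Qed.

(** Otherwise fixed points accumulate at -oo, and prepending ever smaller ones gives a sorted list
    of [N.+1] of them. *)
Lemma deep_neq g : g <> 1 -> deep (fun x => act g x <> x).
Proof.
move=> g1; apply: contrapT => nd.
have nx z : exists2 x, x < z & act g x = x.
  apply: contrapT => h; apply: nd; exists z => x xz e; apply: h.
  by exists x.
have [s [ss fs szs]] : exists s : seq R, [/\ sorted <%R s,
    forall x, x \in s -> act g x = x & size s = N.+1].
  elim: N.+1 => [|n [s [ss fs szs]]]; first by exists [::].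
  have [x xz xe] := nx (head 0 s).
  exists (x :: s); split.
  - by case: s ss fs szs xz => //= a s -> _ _ ->.
  - by move=> y; rewrite inE => /orP[/eqP->|/fs].
  - by rewrite /= szs.
by have := act_fix g1 ss fs; rewrite szs ltnn.
Qed.

Definition ltg g h := deep (fun x => act g x < act h x).

(** By [ltg_total] this amounts to [ltg g h] or [g = h]. *)
Definition leg g h := ~ ltg h g.

Lemma ltg_irr g : ~ ltg g g.
Proof. by move=> /deep_ex[x]; rewrite ltxx. Qed.

Lemma ltg_trans g h k : ltg g h -> ltg h k -> ltg g k.
Proof.
move=> gh hk; apply: deepW (deepI gh hk) => x [].
exact: lt_trans.
Qed.

Lemma ltgW g h : ltg g h -> leg g h.
Proof. by move=> gh hg; apply: (ltg_irr (g := g)); apply: ltg_trans gh hg. Qed.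

Lemma ltgMl k g h : ltg g h -> ltg (k * g) (k * h).
Proof. by apply: deepW => x; rewrite !actM act_lt. Qed.

Lemma ltgMr k g h : ltg g h -> ltg (g * k) (h * k).
Proof. by move=> /(deep_act k); apply: deepW => x; rewrite !actM. Qed.

(** Below all fixed points of [f] the direction of displacement is constant, since a change would
    create one; left invariance reduces the comparison of [g] and [h] to that of 1 and
    [g^-1 * h]. *)
Lemma ltg_total g h : g <> h -> ltg g h \/ ltg h g.
Proof.
suff H f : f <> 1 -> ltg 1 f \/ ltg f 1.
  move=> gh; have /H[] : g^-1 * h <> 1.
  - by move=> /(congr1 ( *%g g)); rewrite mulVKg mulg1 => /esym.
  - by move=> /(ltgMl g); rewrite mulVKg mulg1 => ?; left.
  - by move=> /(ltgMl g); rewrite mulVKg mulg1 => ?; right.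
move=> /deep_neq[z hz].
have [up|] := pselect (forall x, x < z -> x < act f x).
  by left; exists z => x; rewrite act1; apply: up.
move=> /existsNP[y /not_implyP[yz /negP]]; rewrite -leNgt => fy.
right; exists y => x xy; rewrite act1 lt_neqAle leNgt.
have xz := lt_trans xy yz.
apply/andP; split; first by apply/eqP; apply: hz.
apply/negP => fx.
have fy' : act f y < y by rewrite lt_neqAle fy andbT; apply/eqP/hz.
have [s /andP[_ sy] es] := crossing_down xy fx fy'.
by apply: hz es; apply: lt_trans yz.
Qed.

Lemma leg_ltg_trans g h k : leg g h -> ltg h k -> ltg g k.
Proof.
move=> gh hk; have [->//|ne] := pselect (g = h).
by have [/ltg_trans|//] := ltg_total ne; apply.
Qed.

Lemma ltg_leg_trans g h k : ltg g h -> leg h k -> ltg g k.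
Proof.
move=> gh hk; have [<-//|ne] := pselect (h = k).
by have [/(ltg_trans gh)|//] := ltg_total ne.
Qed.

Lemma leg_trans g h k : leg g h -> leg h k -> leg g k.
Proof. by move=> gh hk kg; apply: hk; apply: ltg_leg_trans kg gh. Qed.

Lemma leg_refl g : leg g g. Proof. exact: ltg_irr. Qed.
Arguments leg_refl : clear implicits.

Lemma leg_total g h : leg g h \/ leg h g.
Proof.
by have [|] := pselect (ltg g h); [left; apply: ltgW | right].
Qed.

Lemma legNlt g h : ~ leg g h -> ltg h g.
Proof. exact: contrapT. Qed.

Lemma legMl k g h : leg g h -> leg (k * g) (k * h).
Proof. by move=> gh /(ltgMl k^-1); rewrite !mulKg. Qed.
Arguments legMl k [g h].

Lemma legMr k g h : leg g h -> leg (g * k) (h * k).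
Proof. by move=> gh /(ltgMr k^-1); rewrite !mulgK. Qed.
Arguments legMr k [g h].

Lemma legM g h k l : leg g h -> leg k l -> leg (g * k) (h * l).
Proof. by move=> /(legMr k) gh /(legMl h); apply: leg_trans. Qed.

Lemma ltgM g h k l : ltg g h -> ltg k l -> ltg (g * k) (h * l).
Proof. by move=> /(ltgMr k) gh /(ltgMl h); apply: ltg_trans. Qed.

Lemma legX n g h : leg g h -> leg (g ^+ n) (h ^+ n).
Proof.
move=> gh; elim: n => [|n ih]; first by rewrite !expg0; apply: leg_refl.
by rewrite !expgS; apply: legM.
Qed.
Arguments legX n [g h].

Lemma ltgJ k g h : ltg g h -> ltg (g ^ k) (h ^ k).
Proof. by move=> gh; rewrite !conjgE; apply/ltgMl/ltgMr. Qed.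

Lemma legJ k g h : leg g h -> leg (g ^ k) (h ^ k).
Proof. by move=> gh /(ltgJ k^-1); rewrite !conjgK. Qed.
Arguments legJ k [g h].

Lemma ltgV g h : ltg g h -> ltg h^-1 g^-1.
Proof.
by move=> /(ltgMl g^-1)/(ltgMr h^-1); rewrite mulVg mul1g mulgK.
Qed.

Lemma posM g h : ltg 1 g -> ltg 1 h -> ltg 1 (g * h).
Proof. by move=> /ltgM gh /gh; rewrite mulg1. Qed.

Lemma posX n g : ltg 1 g -> ltg 1 (g ^+ n.+1).
Proof.
move=> pg; elim: n => [|n ih]; first by rewrite expg1.
by rewrite expgS; apply: posM.
Qed.

Lemma posJ k g : ltg 1 g -> ltg 1 (g ^ k).
Proof. by move=> /(ltgJ k); rewrite conj1g. Qed.

Lemma legX_pos m n g : ltg 1 g -> (m <= n)%N -> leg (g ^+ m) (g ^+ n).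
Proof.
move=> pg /subnK <-; rewrite expgnDr -{1}[g ^+ m]mul1g; apply: legMr.
case: (n - m)%N => [|k]; first by rewrite expg0; apply: leg_refl.
exact/ltgW/posX.
Qed.

(** * Infinitesimals and their conjugates *)

Definition infinitesimal b u := forall n, ltg (b ^+ n) u.

Lemma infinitesimal_pos b u : infinitesimal b u -> ltg 1 u.
Proof. by move=> /(_ 0%N); rewrite expg0. Qed.

Lemma infinitesimalJ k b u :
  infinitesimal b u -> infinitesimal (b ^ k) (u ^ k).
Proof. by move=> bu n; rewrite -conjXg; apply: ltgJ. Qed.

Lemma leg_deep g h : leg g h -> deep (fun x => act g x <= act h x).
Proof.
move=> gh; have [->|ne] := pselect (g = h); first by exists 0%R => x _.
by have [|//] := ltg_total ne; apply: deepW => x /ltW.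
Qed.

Lemma actJV k b x : act (b ^ k^-1) x = act k (act b (act k^-1 x)).
Proof. by rewrite conjgE invgK !actM. Qed.

(** Since [x ^ y] is [y^-1 * x * y], this is [u ^+ l * b * (u ^+ l)^-1]: at [x] it reflects what [b]
    does at the deep point [act (u ^+ l)^-1 x]. *)
Definition cj (u : G) (l : nat) (b : G) := b ^ (u ^+ l)^-1.

Lemma cj0 u b : cj u 0 b = b.
Proof. by rewrite /cj expg0 invg1 conjg1. Qed.

Lemma cjS u l b : cj u l.+1 b = cj u l b ^ u^-1.
Proof. by rewrite /cj expgS invgM conjgM. Qed.

Lemma act_cjS u l b x :
  act (cj u l.+1 b) x = act u (act (cj u l b) (act u^-1 x)).
Proof. by rewrite cjS actJV. Qed.

Lemma cjD u k l b : cj u (k + l) b = cj u k (cj u l b).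
Proof. by rewrite /cj expgnDr invgM conjgM. Qed.

Lemma actVX_comm u l x : act (u ^+ l) (act u (act (u ^+ l)^-1 x)) = act u x.
Proof. by rewrite -!actM -expgSr expgS -mulgA mulgV mulg1. Qed.

Lemma deep_orbit u z P x : (forall s, s < z -> s < act u s) -> deep P ->
  x < z -> exists L, forall l, (L <= l)%N -> P (act (u ^+ l)^-1 x).
Proof.
move=> up [t ht] xz.
have [n hn] : exists n, x < act (u ^+ n) t.
  by apply: orbit_escape => s /andP[_ sx]; apply/up/(le_lt_trans sx).
exists n => l /subnK <-; apply: ht; rewrite actV_lt.
elim: (l - n)%N => [|k ih]; first by rewrite add0n.
rewrite addSn expgS actM; apply: (lt_trans (up x xz)).
by rewrite act_lt.
Qed.

(** Turns an inequality of germs into one at the given point [x]: the conjugates compare at [x] as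
    [a] and [b] do at [act (u ^+ l)^-1 x], which tends to -oo. *)
Lemma cj_lt u z a b x : (forall s, s < z -> s < act u s) -> ltg a b -> x < z ->
  exists L, forall l, (L <= l)%N -> act (cj u l a) x < act (cj u l b) x.
Proof.
move=> up ab xz; have [L hL] := deep_orbit up ab xz.
by exists L => l /hL h; rewrite /cj !actJV act_lt.
Qed.

(** Conjugation by [u ^+ l] preserves [u], so the deep bound of [b ^+ j] by [u] is carried to [x];
    [l] depends on [j]. *)
Lemma infinitesimal_iter u z b x j : (forall s, s < z -> s < act u s) ->
  infinitesimal b u -> x < z -> exists l, act (cj u l b ^+ j) x < act u x.
Proof.
move=> up /(_ j) bu xz; have [L /(_ L (leqnn L)) h] := deep_orbit up bu xz.
by exists L; rewrite /cj -conjXg actJV -(actVX_comm u L x) act_lt.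
Qed.

(* Otherwise the powers of [b], being bounded by those of its conjugates by
   [u ^+ l], would stay below [u] at every deep point, and [b] would have deep
   fixed points. *)
Lemma infinitesimal_conj_lt b u : ltg 1 b -> infinitesimal b u ->
  ltg (b ^ u^-1) b.
Proof.
move=> pb bu; apply: contrapT => /leg_deep ble.
have [z hz] := deepI ble (deepI pb (infinitesimal_pos bu)).
have le1 s : s < z -> act b s <= act (b ^ u^-1) s by move=> /hz[].
have up s : s < z -> s < act u s by move=> /hz[_ []]; rewrite act1.
have bp s : s < z -> s < act b s by move=> /hz[_ []]; rewrite act1.
have [x [xz uxz]] := deep_ex (deepI (deep_lt z) (deep_act u (deep_lt z))).
have lel l s : s < z -> act b s <= act (cj u l b) s.
  elim: l s => [|l ih] s sz; first by rewrite cj0.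
  rewrite act_cjS (le_trans (le1 _ sz))// actJV act_le ih//.
  by rewrite (lt_trans _ sz)// actV_lt up.
(* Strong induction: the earlier points of the [b]-orbit stay below [act u x < z], where [lel]
   applies. *)
have bd j : act (b ^+ j) x < act u x.
  elim/ltn_ind: j => j ih.
  have [l] := infinitesimal_iter j up bu xz; apply: le_lt_trans.
  suff : forall i, (i <= j)%N -> act (b ^+ i) x <= act (cj u l b ^+ i) x by apply.
  elim=> [_|i ihi ij]; first by rewrite !expg0.
  rewrite !expgS (actM b) (actM (cj u l b)) (le_trans (lel l _ _))//.
    by rewrite (lt_trans (ih _ ij)).
  by rewrite act_le ihi// ltnW.
have [s /andP[_ su] es] := orbit_sup (ltW (bp x xz)) (fun j => ltW (bd j)).
by have := bp s (le_lt_trans su uxz); rewrite es ltxx.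
Qed.

Definition right_fixed u b y := forall t, y < t ->
  exists L, forall l, (L <= l)%N -> act (cj u l b) y < t.

(** The infimum of the conjugates may jump at [y], so here only the points below [y] are kept from
    crossing it. *)
Definition left_fixed u b y := forall t, t < y ->
  exists L, forall l, (L <= l)%N -> act (cj u l b) t < y.

(* With F the infimum of the conjugates, either F fixes a deep point, or the
   supremum of an F-orbit, which is bounded since b is infinitesimal, cannot
   be jumped over from the left. *)
Lemma exists_limit_fixed u b z : ltg 1 b -> infinitesimal b u ->
  exists2 y, y < z & right_fixed u b y \/ left_fixed u b y.
Proof.
move=> pb bu; have dec := infinitesimal_conj_lt pb bu.
have [z' hz] := deepI (deepI (deep_lt z) dec) (deepI pb (infinitesimal_pos bu)).
have zz s : s < z' -> s < z by move=> /hz[[]].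
have le1 s : s < z' -> act (b ^ u^-1) s <= act b s by move=> /hz[[_ /ltW]].
have up s : s < z' -> s < act u s by move=> /hz[_ []]; rewrite act1.
have bp s : s < z' -> s < act b s by move=> /hz[_ []]; rewrite act1.
have uV s : s < z' -> act u^-1 s < z'.
  by move=> sz; rewrite (lt_trans _ sz)// actV_lt up.
have decS l s : s < z' -> act (cj u l.+1 b) s <= act (cj u l b) s.
  elim: l s => [|l ih] s sz; first by rewrite cjS cj0 le1.
  by rewrite (act_cjS u l.+1) (act_cjS u l b s) act_le ih// uV.
have decl k l s : s < z' -> (k <= l)%N ->
    act (cj u l b) s <= act (cj u k b) s.
  move=> sz /subnK <-; elim: (l - k)%N => [|i ih]; first by rewrite add0n.
  by rewrite addSn (le_trans (decS _ _ sz)).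
have inc l s : s < z' -> s < act (cj u l b) s.
  elim: l s => [|l ih] s sz; first by rewrite cj0 bp.
  by rewrite act_cjS -{1}(actVK u s) act_lt ih// uV.
pose F s := inf (range (fun l => act (cj u l b) s)).
have F0 s : range (fun l => act (cj u l b) s) !=set0.
  by exists (act (cj u 0 b) s); exists 0%N.
have Fle l s : s < z' -> F s <= act (cj u l b) s.
  move=> sz; apply: ge_inf; last by exists l.
  by exists s => _ [k _ <-]; apply/ltW/inc.
have Flt s t : s < z' -> F s < t ->
    exists L, forall l, (L <= l)%N -> act (cj u l b) s < t.
  move=> sz /(inf_lt (F0 s))[_ [L _ <-] Lt].
  by exists L => l Ll; apply: le_lt_trans Lt; apply: decl.
have [|nR] := pselect (exists2 y, y < z' & right_fixed u b y).
  by move=> [y yz hy]; exists y; [apply: zz|left].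
have Fgt s : s < z' -> s < F s.
  move=> sz; rewrite ltNge; apply/negP => Fs; apply: nR; exists s => // t st.
  by apply: Flt => //; apply: le_lt_trans st.
have [x [xz uxz]] := deep_ex (deepI (deep_lt z') (deep_act u (deep_lt z'))).
(* The F-orbit lies below the orbit of every single conjugate, and for each [j] some conjugate has
   its [j]-th iterate below [act u x]. *)
have fP j : iter j F x < act u x /\
    forall l, iter j F x <= act (cj u l b ^+ j) x.
  elim: j => [|j [ih1 ih2]].
    by split=> [|l]; [exact: up|rewrite expg0 act1].
  have fz := lt_trans ih1 uxz.
  have hl l : iter j.+1 F x <= act (cj u l b ^+ j.+1) x.
    by rewrite iterS expgS actM (le_trans (Fle l _ fz))// act_le.
  split=> //.
  by have [l] := infinitesimal_iter j.+1 up bu xz; apply: le_lt_trans.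
have fz j : iter j F x < z' by apply: lt_trans uxz; exact: (fP j).1.
pose E := range (fun j => iter j F x).
have E0 : E !=set0 by exists x; exists 0%N.
have ubE : has_ubound E by exists (act u x) => _ [j _ <-]; apply/ltW/(fP j).1.
have yz : sup E < z'.
  by apply: le_lt_trans uxz; apply: ge_sup => // _ [j _ <-]; apply/ltW/(fP j).1.
exists (sup E); [exact: zz|right] => t ty.
have [_ [j _ <-] tj] := sup_gt E0 ty.
have : F (iter j F x) < sup E.
  (* One iterate more than needed makes the inequality strict. *)
  have : iter j.+2 F x <= sup E by apply: ub_le_sup => //; exists j.+2.
  by apply: lt_le_trans; exact: Fgt (fz j.+1).
move=> /(Flt _ _ (fz j))[L hL]; exists L => l /hL.
by apply: lt_trans; rewrite act_lt.
Qed.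

(** For large [l] the conjugate of [a] lies below that of [b] at [y]; hence a point found for the
    largest element of a chain serves the whole chain. *)
Lemma right_fixed_le u z a b y : (forall s, s < z -> s < act u s) ->
  leg a b -> y < z -> right_fixed u b y -> right_fixed u a y.
Proof.
move=> up ab yz hb t /hb[L hL].
have [e|ne] := pselect (a = b); first by exists L; rewrite e.
have [ab'|//] := ltg_total ne; have [K hK] := cj_lt up ab' yz.
exists (maxn K L) => l; rewrite geq_max => /andP[/hK h /hL].
exact: lt_trans.
Qed.

Lemma left_fixed_le u z a b y : (forall s, s < z -> s < act u s) ->
  leg a b -> y < z -> left_fixed u b y -> left_fixed u a y.
Proof.
move=> up ab yz hb t ty; have [L hL] := hb t ty.
have [e|ne] := pselect (a = b); first by exists L; rewrite e.
have [ab'|//] := ltg_total ne; have [K hK] := cj_lt up ab' (lt_trans ty yz).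
exists (maxn K L) => l; rewrite geq_max => /andP[/hK h /hL].
exact: lt_trans.
Qed.

(** Conjugating by [u ^+ k] only shifts the index [l], so one point yields arbitrarily deep ones. *)
Lemma right_fixed_shift k u b y :
  right_fixed u b y -> right_fixed u b (act (u ^+ k)^-1 y).
Proof.
move=> hb t; rewrite actV_lt => /hb[L hL]; exists L => l Ll.
rewrite -(act_lt (u ^+ k)) -actJV -/(cj u k _) -cjD.
by apply: hL; apply: leq_trans (leq_addl _ _).
Qed.

Lemma left_fixed_shift k u b y :
  left_fixed u b y -> left_fixed u b (act (u ^+ k)^-1 y).
Proof.
move=> hb t; rewrite lt_actV => /hb[L hL]; exists L => l Ll.
rewrite -(act_lt (u ^+ k)) actVK -{1}(actK (u ^+ k) t).
rewrite -actJV -/(cj u k _) -cjD.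
by apply: hL; apply: leq_trans (leq_addl _ _).
Qed.

(* The step is [w^-1 * c] where the conjugates fix [y] from the right, and
   [c * w^-1] where they fix it from the left. *)
Definition reverses (step : G -> G -> G) u b y := forall w,
  (y < act w y ->
    exists L, forall l, (L <= l)%N -> act (step w (cj u l b)) y < y) /\
  (act w y < y ->
    exists L, forall l, (L <= l)%N -> y < act (step w (cj u l b)) y).

Lemma cj_up u z b y : (forall s, s < z -> s < act u s) -> ltg 1 b -> y < z ->
  exists L, forall l, (L <= l)%N -> y < act (cj u l b) y.
Proof.
move=> up pb yz; have [L hL] := cj_lt up pb yz.
by exists L => l /hL; rewrite /cj conj1g act1.
Qed.

Lemma reverses_right u z b y : (forall s, s < z -> s < act u s) -> ltg 1 b ->
  y < z -> right_fixed u b y -> reverses (fun w c => w^-1 * c) u b y.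
Proof.
move=> up pb yz hb w; split=> [/hb[L hL]|wy].
  by exists L => l /hL h; rewrite (actM w^-1) actV_lt.
have [L hL] := cj_up up pb yz; exists L => l /hL h.
by rewrite (actM w^-1) lt_actV (lt_trans wy).
Qed.

Lemma reverses_left u z b y : (forall s, s < z -> s < act u s) -> ltg 1 b ->
  y < z -> left_fixed u b y -> reverses (fun w c => c * w^-1) u b y.
Proof.
move=> up pb yz hb w; split=> [|wy].
  rewrite -actV_lt => /hb[L hL]; exists L => l /hL h.
  by rewrite (actM (cj u l b)).
have [L hL] := cj_up up pb yz; exists L => l /hL h.
by rewrite (actM (cj u l b)) (lt_trans h)// act_lt lt_actV.
Qed.

(** * Words with alternating displacements *)

Fixpoint alternates (up : bool) w (s : seq R) := if s is y :: s' then
  (if up then y < act w y else act w y < y) /\ alternates (~~ up) w s'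
  else True.

(** Finitely many points have a common threshold [L], so all directions flip at once. *)
Lemma alternates_step step u b up w s :
  (forall y, y \in s -> reverses step u b y) -> alternates up w s ->
  exists L, forall l, (L <= l)%N -> alternates (~~ up) (step w (cj u l b)) s.
Proof.
elim: s up => [|y s ih] up hs; first by exists 0%N.
move=> [hy /ih[t ts|L hL]]; first by apply: hs; rewrite inE ts orbT.
have [K hK] : exists K, forall l, (K <= l)%N ->
    if ~~ up then y < act (step w (cj u l b)) y
    else act (step w (cj u l b)) y < y.
  have [h1 h2] := hs y (mem_head _ _) w.
  by clear ih hL; case: up hy => [/h1|/h2].
exists (maxn K L) => l; rewrite geq_max => /andP[/hK h /hL h'].
by split.
Qed.

Lemma alternates_fixed up w y s : sorted <%R (y :: s) ->
  alternates up w (y :: s) -> exists p : seq R, [/\ path <%R y p,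
    forall x, x \in p -> act w x = x & size p = size s].
Proof.
elim: s y up => [|t s ih] y up; first by exists [::].
move=> /= /andP[yt st] [hy [ht hs]].
have [p [sp fp szp]] := ih t (~~ up) st (conj ht hs).
have [x /andP[yx xt] ex] : exists2 x, y < x < t & act w x = x.
  by clear ih hs; case: up hy ht => hy ht;
    [exact: (crossing_down yt hy ht)|exact: (crossing yt hy ht)].
exists (x :: p); split; last by rewrite /= szp.
  rewrite /= yx /=; case: p sp {fp szp} => //= a p /andP[ta ->].
  by rewrite (lt_trans xt ta).
by move=> v; rewrite inE => /orP[/eqP->|/fp].
Qed.

(** From [w := b 0], each step combines [w^-1] with a far conjugate of the next [b i]. This flips
    the direction at all chosen points, while the new word is still positive and so moves some
    deeper point up. After [N.+1] steps there are [N.+2] alternating points, hence [N.+1] fixed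
    points. *)
Lemma chain_bound u (b : nat -> G) :
  (forall i, (i <= N.+1)%N -> ltg 1 (b i)) -> infinitesimal (b N.+1) u ->
  (forall i l, (i <= N)%N -> ltg (b i) (cj u l (b i.+1))) -> False.
Proof.
move=> pb bu chain.
have [z hz] := infinitesimal_pos bu.
have up s : s < z -> s < act u s by move=> /hz; rewrite act1.
have ble i : (i <= N.+1)%N -> leg (b i) (b N.+1).
  move=> iN; rewrite -(subnKC iN); have : (i + (N.+1 - i) <= N.+1)%N by lia.
  elim: (N.+1 - i)%N => [_|k ih kN]; first by rewrite addn0; apply: leg_refl.
  have kN' : (i + k <= N)%N by lia.
  apply: leg_trans (ih (leqW kN')) _; apply: ltgW.
  by have := chain _ 0%N kN'; rewrite cj0 addnS.
have pbN := pb _ (leqnn N.+1).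
have [y yz hy] := exists_limit_fixed z pbN bu.
have zV k : act (u ^+ k)^-1 y < z.
  elim: k => [|k ih]; first by rewrite expg0 invg1 act1.
  by rewrite expgSr invgM actM (lt_trans _ ih)// actV_lt up.
have [step [step_pos step_rev]] : exists step : G -> G -> G,
    (forall w c, ltg 1 w -> ltg w c -> ltg 1 (step w c) /\ ltg (step w c) c) /\
    (forall k i, (i <= N.+1)%N ->
      reverses step u (b i) (act (u ^+ k)^-1 y)).
  case: hy => hy.
    exists (fun w c => w^-1 * c); split=> [w c pw wc|k i iN].
      split; first by have := ltgMl w^-1 wc; rewrite mulVg.
      by have := ltgMr c (ltgV pw); rewrite invg1 mul1g.
    apply: (reverses_right up (pb _ iN) (zV k)).
    exact: right_fixed_le up (ble _ iN) (zV k) (right_fixed_shift (k := k) hy).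
  exists (fun w c => c * w^-1); split=> [w c pw wc|k i iN].
    split; first by have := ltgMr w^-1 wc; rewrite mulgV.
    by have := ltgMl c (ltgV pw); rewrite invg1 mulg1.
  apply: (reverses_left up (pb _ iN) (zV k)).
  exact: left_fixed_le up (ble _ iN) (zV k) (left_fixed_shift (k := k) hy).
have new w t : ltg 1 w -> exists k, act (u ^+ k)^-1 y < t /\
    act (u ^+ k)^-1 y < act w (act (u ^+ k)^-1 y).
  move=> pw; have [L /(_ L (leqnn L))] := deep_orbit up (deepI (deep_lt t) pw) yz.
  by rewrite act1; exists L.
(* The bound of [w] by a conjugate of [b i] keeps the next word positive. *)
have main i : (i <= N.+1)%N -> exists w l s, [/\ ltg 1 w, leg w (cj u l (b i)),
    alternates true w s, sorted <%R s &
    (forall x, x \in s -> exists k, x = act (u ^+ k)^-1 y) /\ size s = i.+1].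
  elim: i => [_|i ih iN].
    (* The threshold 0 is arbitrary: there is no earlier point to stay below. *)
    have [k [_ hk]] := new (b 0%N) 0%R (pb 0%N isT).
    exists (b 0%N), 0%N, [:: act (u ^+ k)^-1 y]; split=> //.
    - exact: pb.
    - by rewrite cj0; apply: leg_refl.
    - by split=> // x; rewrite inE => /eqP->; exists k.
  have [w [l [s [pw wl alt ss [hs szs]]]]] := ih (ltnW iN).
  have [|L hL] := @alternates_step step u (b i.+1) true w s _ alt.
    by move=> x /hs[k ->]; apply: step_rev.
  (* The chain condition for [L], conjugated by [u ^+ l], bounds [cj u l (b i)]. *)
  have wlt : ltg w (cj u (l + L) (b i.+1)).
    by apply: leg_ltg_trans wl _; rewrite cjD; apply/ltgJ/chain.
  have [pw' w'l] := step_pos _ _ pw wlt.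
  have [k [kt hk]] := new _ (head 0%R s) pw'.
  exists (step w (cj u (l + L) (b i.+1))), (l + L)%N, (act (u ^+ k)^-1 y :: s).
  split=> //.
  - exact: ltgW.
  - by split=> //; apply: hL; apply: leq_addl.
  - by case: s ss kt {alt hs szs hL} => //= a s -> ->.
  - split; last by rewrite /= szs.
    by move=> x; rewrite inE => /orP[/eqP->|/hs//]; exists k.
have [w [_ [[|x s] [pw _ alt ss [_ //]]]]] := main _ (leqnn _).
move=> -[szs].
have [p [sp fp szp]] := alternates_fixed ss alt.
have w1 : w <> 1 by move=> e; move: pw; rewrite e; apply: ltg_irr.
by have := act_fix w1 (path_sorted sp) fp; rewrite szp szs ltnn.
Qed.

(** * Existence of a smallest archimedean class *)

Lemma infinitesimal_ltg a x y : infinitesimal a x -> leg x y ->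
  infinitesimal a y.
Proof. by move=> ax xy n; apply: ltg_leg_trans (ax n) xy. Qed.

(* Otherwise the conjugates of [b] by the powers of [v] form an infinite
   descending chain of archimedean classes, each of which drops by at most one
   step under conjugation by powers of [b]. *)
Lemma conj_not_infinitesimal v b : ltg 1 b -> infinitesimal b v ->
  ~ infinitesimal (b ^ v^-1) b.
Proof.
move=> pb bv drop; pose t k := cj v k b.
have pt k : ltg 1 (t k) by apply: posJ.
have tS k : infinitesimal (t k.+1) (t k).
  by rewrite /t -addn1 cjD cjS cj0; apply: infinitesimalJ.
have tb k : leg (t k) b.
  elim: k => [|k ih]; first by rewrite /t cj0; apply: leg_refl.
  by apply: leg_trans ih; apply: ltgW; have := tS k 1%N; rewrite expg1.
have key k l : ltg (t k.+2) (cj b l (t k.+1)).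
  (* [infinitesimal_conj_lt] is applied with [(b ^+ l)^-1 * v] in place of [v]; conjugating its
     conclusion by [(b ^+ l)^-1] gives the claim. *)
  have inf : infinitesimal (t k.+1) ((b ^+ l)^-1 * v).
    move=> n; rewrite -(mulKg (b ^+ l) (t k.+1 ^+ n)); apply: ltgMl.
    apply: ltg_trans (bv l.+1); rewrite expgSr; apply: ltgMl.
    exact: infinitesimal_ltg (tS k) (tb k) n.
  have := ltgJ (b ^+ l)^-1 (infinitesimal_conj_lt (pt k.+1) inf).
  by rewrite invgM invgK -conjgM mulgK -cjS.
(* Reversed indices turn the descent into an increasing chain from [t N.+2] to [t 1]. *)
apply: (@chain_bound b (fun i => t (N.+2 - i)%N)) => [i _||i l iN].
- exact: pt.
- by rewrite subSnn; apply: infinitesimal_ltg (tS 0%N) (tb 0%N).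
- by rewrite subSS !subSn//; last by apply: leqW.
Qed.

(** Otherwise every positive infinitesimal has a positive element below all its conjugates by powers
    of [u]; iterating this choice contradicts [chain_bound]. *)
Lemma exists_coinitial u b : ltg 1 b -> infinitesimal b u ->
  exists b', [/\ ltg 1 b', infinitesimal b' u &
    forall c, ltg 1 c -> exists l, leg (cj u l b') c].
Proof.
move=> pb bu; apply: contrapT => nex.
have /choice[f hf] x : exists c, ltg 1 x -> infinitesimal x u ->
    ltg 1 c /\ forall l, ltg c (cj u l x).
  apply: contrapT => /forallNP nc.
  have px : ltg 1 x by apply: contrapT => h; apply: (nc 1).
  have ux : infinitesimal x u by apply: contrapT => h; apply: (nc 1).
  apply: nex; exists x; split=> // c pc; apply: contrapT => /forallNP hc.
  by apply: (nc c) => _ _; split=> // l; apply/legNlt/hc.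
have hi i : ltg 1 (iter i f b) /\ infinitesimal (iter i f b) u.
  elim: i => //= i [ih1 ih2]; have [h1 h2] := hf _ ih1 ih2; split=> // n.
  by apply: leg_ltg_trans (ih2 n); apply/legX/ltgW; have := h2 0%N; rewrite cj0.
apply: (@chain_bound u (fun i => iter (N.+1 - i) f b)) => [i _||i l iN].
- exact: (hi _).1.
- by rewrite subnn.
- rewrite subSn// subSS /=; exact: (hf _ (hi _).1 (hi _).2).2.
Qed.

(** If nothing positive is infinitesimal to [u], then [u] works. Otherwise a coinitial [b] does:
    every positive [c] is above some [cj u l b], and by [conj_not_infinitesimal] a power of that
    conjugate reaches [b]. *)
Lemma exists_smallest_class (g : G) : g <> 1 ->
  exists2 a, ltg 1 a & forall c, ltg 1 c -> exists n, leg a (c ^+ n).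
Proof.
move=> g1.
have [u pu] : exists u, ltg 1 u.
  have [/ltgV|] := ltg_total g1; last by exists g.
  by rewrite invg1; exists g^-1.
have [[b [pb bu]]|nb] := pselect (exists b, ltg 1 b /\ infinitesimal b u); last first.
  exists u => // c pc; apply: contrapT => /forallNP h.
  by apply: nb; exists c; split=> // n; apply/legNlt/h.
have {b pb bu}[b [pb bu co]] := exists_coinitial pb bu; exists b => // c pc.
have [l lc] := co c pc.
suff [n hn] : exists n, leg b (cj u l b ^+ n).
  by exists n; apply: leg_trans hn _; apply: legX.
(* The case [l = 0] is apart because [b] is not infinitesimal to [u ^+ 0]. *)
case: l lc => [|l] _; first by exists 1%N; rewrite cj0 expg1; apply: leg_refl.
have bul : infinitesimal b (u ^+ l.+1).
  by apply: infinitesimal_ltg bu _; rewrite -{1}(expg1 u); apply: legX_pos.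
apply: contrapT => /forallNP h; apply: (conj_not_infinitesimal pb bul) => n.
exact/legNlt/h.
Qed.

(** * Commutation within the smallest class *)

Lemma archimedean_floor d x (K : nat) : leg 1 x -> ltg x (d ^+ K) ->
  exists k, leg (d ^+ k) x /\ ltg x (d ^+ k.+1).
Proof.
move=> x1; elim: K => [|K ih]; first by rewrite expg0.
by have [/ih//|h] := pselect (ltg x (d ^+ K)); exists K.
Qed.

(* Hölder's theorem. *)
Lemma archimedean_commute a x y :
  (forall c, ltg 1 c -> exists n, leg a (c ^+ n)) ->
  ltg 1 x -> (exists m, leg x (a ^+ m)) ->
  ltg 1 y -> (exists m, leg y (a ^+ m)) -> x * y = y * x.
Proof.
move=> arch.
have floor d z : ltg 1 d -> ltg 1 z -> (exists m, leg z (a ^+ m)) ->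
    exists k, leg (d ^+ k) z /\ ltg z (d ^+ k.+1).
  move=> pd pz [m zm]; have [n an] := arch d pd.
  apply: (@archimedean_floor d z (n * m).+1); first exact: ltgW.
  apply: leg_ltg_trans (leg_trans zm (legX m an)) _.
  by rewrite -expgnA expgS -{1}[d ^+ _]mul1g; apply: ltgMr.
(* With a least positive element [m], both [x] and [y] are powers of [m]; otherwise positive
   elements can be halved. *)
have [[m pm mmin]|nmin] := pselect (exists2 m, ltg 1 m &
    forall c, ltg 1 c -> leg m c).
  have pow z : ltg 1 z -> (exists m, leg z (a ^+ m)) -> exists k, z = m ^+ k.
    move=> pz /(floor m z pm pz)[k [kz zk]]; exists k.
    have [//|ne] := pselect (z = m ^+ k).
    have [/kz//|] := ltg_total ne; move=> /(ltgMl (m ^+ k)^-1).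
    rewrite mulVg => /mmin; case.
    by have := ltgMl (m ^+ k)^-1 zk; rewrite expgSr mulKg.
  move=> px /(pow _ px)[k ->] py /(pow _ py)[j ->].
  exact/commuteX2/commute_refl.
have half c : ltg 1 c -> exists2 d, ltg 1 d & leg (d * d) c.
  move=> pc; have [e [pe ec]] : exists e, ltg 1 e /\ ltg e c.
    apply: contrapT => /forallNP h; apply: nmin; exists c => // e pe ec.
    by apply: (h e).
  have pr : ltg 1 (e^-1 * c) by have := ltgMl e^-1 ec; rewrite mulVg.
  have [h|h] := leg_total e (e^-1 * c).
    by exists e => //; have := legMl e h; rewrite mulVKg.
  exists (e^-1 * c) => //; have := legMr (e^-1 * c) h; rewrite mulVKg.
  exact.
suff comm z w : ltg 1 z -> (exists m, leg z (a ^+ m)) ->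
    ltg 1 w -> (exists m, leg w (a ^+ m)) -> ~ ltg (w * z) (z * w).
  move=> px ax py ay; have [//|ne] := pselect (x * y = y * x).
  by have [/comm|/comm] := ltg_total ne; case.
move=> pz az pw aw zw.
(* If [d ^+ p] and [d ^+ q] are the floors of [z] and [w], then [z * w] is below [d ^+ (p + q + 2)],
   hence below [d * d * (w * z)], against the choice of [d]. *)
have [d pd dd] : exists2 d, ltg 1 d & leg (d * d) (z * w * (w * z)^-1).
  by apply: half; have := ltgMr (w * z)^-1 zw; rewrite mulgV.
have [p [pz1 pz2]] := floor d z pd pz az.
have [q [qw1 qw2]] := floor d w pd pw aw.
have h1 : leg (d * d * (w * z)) (z * w).
  by have := legMr (w * z) dd; rewrite mulgVK.
apply: h1; apply: ltg_leg_trans (ltgM pz2 qw2) _.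
rewrite -expgnDr addSn addnS addnC !expgS -mulgA expgnDr.
by do 2 apply: legMl; apply: legM.
Qed.

(** Minimality is applied to [a ^ g^-1], and the result conjugated by [g]. *)
Lemma conj_archimedean a g : ltg 1 a ->
  (forall c, ltg 1 c -> exists n, leg a (c ^+ n)) ->
  exists n, leg (a ^ g) (a ^+ n).
Proof.
move=> pa /(_ (a ^ g^-1) (posJ _ pa))[n hn]; exists n.
by have := legJ g hn; rewrite conjXg conjgKV.
Qed.

(** * Free conjugates and small elements *)

Lemma infinitely_fixed g (f : nat -> R) : (forall n, f n < f n.+1) ->
  (forall n, act g (f n) = f n) -> g = 1.
Proof.
move=> fS ff; apply: contrapT => g1.
have sf n m : sorted <%R [seq f i | i <- iota m n].
  by elim: n m => // -[|n] ih m //=; rewrite fS; apply: (ih m.+1).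
have := act_fix g1 (sf N.+1 0%N); rewrite size_map size_iota ltnn => h.
by have : false by apply: h => _ /mapP[i _ ->].
Qed.

(** If [c] moved [p], then [d] would fix the infinite monotone orbit of [p] under [c] or [c^-1]. *)
Lemma commute_fixed (d c : G) p : d <> 1 -> commute d c -> act d p = p ->
  act c p = p.
Proof.
move=> d1; have up e : commute d e -> act d p = p -> ~ p < act e p.
  move=> de dp pe; apply: d1; apply: (infinitely_fixed (f := fun n => act (e ^+ n) p)).
    move=> n; rewrite -{1}[e]mul1g; rewrite mul1g expgSr actM act_lt//.
  by move=> n; rewrite -actM (commuteX n de) actM dp.
move=> dc dp; apply/eqP; rewrite eq_le; apply/andP; split; rewrite leNgt; apply/negP.
  exact: up dc dp.
by rewrite -lt_actV; apply: up dp; apply: commuteV.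
Qed.

Lemma fixed_free_up d x : ltg 1 d -> (forall y, act d y <> y) -> x < act d x.
Proof.
move=> pd free; have [y [yx]] := deep_ex (deepI (deep_lt x) pd).
rewrite act1 => yd; rewrite lt_neqAle leNgt; apply/andP; split.
  by apply/eqP => e; apply: (free x).
by apply/negP => xd; have [s _ /free] := crossing_down yx yd xd.
Qed.

Section Proximal.
Hypothesis proximal : forall s t p q, s < t -> p < q ->
  exists g, s < act g p /\ act g q < t.

(** If [d] fixes [p], so does every [a ^ g]; thus [a] fixes the orbit of [p], which proximality
    makes unbounded. *)
Lemma centralizer_free (a d : G) : a <> 1 -> (forall g, commute d (a ^ g)) ->
  d <> 1 -> forall x, act d x <> x.
Proof.
move=> a1 dc d1 p dp; apply: a1.
have /choice[f hf] z : exists g, z < act g p.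
  have [||g [zg _]] := proximal (s := z) (t := (z + 1)%R) (p := p) (q := (p + 1)%R).
  - by lra.
  - by lra.
  - by exists g.
pose F := fix F n := act (f (if n is m.+1 then F m else 0%R)) p.
apply: (infinitely_fixed (f := F)) => [n|n]; first exact: hf.
have fixed g : act a (act g p) = act g p.
  have := commute_fixed d1 (dc g) dp; rewrite conjgE !actM => h.
  by rewrite -{2}h actVK.
by case: n => [|n]; apply: fixed.
Qed.

(** Each constraint is met by some conjugate of [a], and the smallest of these conjugates meets them
    all. *)
Lemma exists_small_up (L : seq (R * R)) :
  (forall p, p \in L -> p.1 < p.2) ->
  exists c, (forall x, x < act c x) /\ forall p, p \in L -> act c p.1 < p.2.
Proof.
have [g [g0 _]] : exists g, 0%R < act g 0%R /\ act g 1%R < 1%R.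
  by apply: proximal; lra.
have /exists_smallest_class[a pa arch] : g <> 1.
  by move=> e; move: g0; rewrite e act1 ltxx.
have a1 : a <> 1 by move=> e; move: pa; rewrite e; apply: ltg_irr.
have comm h k : commute (a ^ h) (a ^ k).
  by apply: (archimedean_commute arch);
    by [apply: posJ | apply: conj_archimedean].
have up h x : x < act (a ^ h) x.
  apply: fixed_free_up; first exact: posJ.
  apply: (centralizer_free a1); first by move=> k; apply: comm.
  by move=> /eqP; rewrite conjg_eq1 => /eqP.
(* Quotients of conjugates act freely as well, so the order at -oo holds at every point. *)
have le h k x : leg (a ^ h) (a ^ k) -> act (a ^ h) x <= act (a ^ k) x.
  move=> hk; have [->//|ne] := pselect (a ^ h = a ^ k).
  have [lt|//] := ltg_total ne.
  have pd : ltg 1 ((a ^ h)^-1 * a ^ k).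
    by have := ltgMl (a ^ h)^-1 lt; rewrite mulVg.
  rewrite -(mulVKg (a ^ h) (a ^ k)) actM act_le; apply/ltW/fixed_free_up => //.
  apply: (centralizer_free a1); last by move=> e; move: pd; rewrite e; apply: ltg_irr.
  move=> l; apply/commute_sym/commuteM; last exact: comm.
  by apply: commuteV; apply: comm.
suff : (forall p, p \in L -> p.1 < p.2) ->
    exists h, forall p, p \in L -> act (a ^ h) p.1 < p.2.
  by move=> H /H[h hh]; exists (a ^ h).
elim: L => [_|[s t] L ih hL]; first by exists 1.
have [p pL|h hh] := ih; first by apply: hL; rewrite inE pL orbT.
have a0 : 0%R < act a 0%R by rewrite -(conjg1 a).
(* As [k] maps [0, a 0] into (s, t), its conjugate [k * a * k^-1] sends [s] below [act k (act a 0)],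
   hence below [t]. *)
have [k [sk kt]] := proximal (hL (s, t) (mem_head _ _)) a0.
have kst : act (a ^ k^-1) s < t.
  by rewrite actJV (lt_trans _ kt)// !act_lt actV_lt.
have tail l : leg (a ^ l) (a ^ h) -> forall p, p \in L -> act (a ^ l) p.1 < p.2.
  by move=> lh p pL; apply: le_lt_trans (hh p pL); apply: le.
have [hk|kh] := leg_total (a ^ h) (a ^ k^-1).
  exists h => p; rewrite inE => /orP[/eqP->|/hh//].
  by apply: le_lt_trans kst; apply: le.
exists k^-1 => p; rewrite inE => /orP[/eqP->//|].
exact: tail.
Qed.
End Proximal.

End LineAction.

(** * Transfer from the unit interval to the line *)

Section UnitInterval.
Set Implicit Arguments.
Unset Strict Implicit.
Context (R : realType).
Local Notation X := (unit_interval R).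

(** [expand] inverts the embedding [contract] of the line onto (-1, 1), rescaled here to (0, 1). At
    0 and 1 the value is the default of [fine]. *)
Definition to_real (t : R) : R := fine (expand (2 * t - 1)).

Lemma of_real_subproof (r : R) : (contract r%:E + 1) / 2 \in (`[0, 1]%classic : set R).
Proof.
have := contract_lt1 r; rewrite ltr_norml; set c := contract _ => /andP[h1 h2].
by rewrite inE /= in_itv /=; apply/andP; split; lra.
Qed.

Definition of_real (r : R) : X := SigSub (of_real_subproof r).

Lemma of_realE r : \val (of_real r) = (contract r%:E + 1) / 2.
Proof. by []. Qed.

Lemma unit_interval_itv (x : X) : 0 <= \val x <= 1.
Proof. by have := set_mem (valP x); rewrite /= in_itv. Qed.

Lemma of_real_itv r : 0 < \val (of_real r) < 1.
Proof.
have := contract_lt1 r; rewrite ltr_norml of_realE => /andP[h1 h2].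
by apply/andP; split; lra.
Qed.

Lemma lt_of_real : {mono of_real : x y / x < y >-> \val x < \val y}.
Proof.
move=> x y; rewrite !of_realE ltr_pM2r// ltrD2r; exact: lt_contract.
Qed.

Lemma to_realK t : 0 < t < 1 -> \val (of_real (to_real t)) = t.
Proof.
move=> /andP[t0 t1].
have ht : `|2 * t - 1| < 1 by rewrite ltr_norml; apply/andP; split; lra.
rewrite of_realE /to_real fine_expand// expandK; first by lra.
by rewrite inE ltW.
Qed.

Lemma of_realK r : to_real (\val (of_real r)) = r.
Proof.
have h : 2 * \val (of_real r) - 1 = contract r%:E by rewrite of_realE; lra.
rewrite /to_real h.
suff -> : expand (contract r%:E) = r%:E by [].
by apply: contract_inj; rewrite expandK// inE contract_le1.
Qed.

Context (Gamma : set (X -> X)) (hGamma : homeo_subgroup Gamma).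

(** The proof is a parameter of the type so that the group structure can be inferred from it. *)
Definition homeo_group of homeo_subgroup Gamma := {g : X -> X | Gamma g}.
Local Notation G := (homeo_group hGamma).

Lemma homeo_inv_subproof (g : G) : exists f : G,
  cancel (sval g) (sval f) /\ cancel (sval f) (sval g).
Proof.
case: g => g gG; have [_ [h _ [gh hg]] _] := homeo_subgroup_sub hGamma gG.
by exists (exist _ h (homeo_subgroup_inv hGamma gG gh hg)).
Qed.

Definition homeo_one : G := exist _ id (homeo_subgroup_id hGamma).
Definition homeo_mul (f g : G) : G :=
  exist _ (sval f \o sval g) (homeo_subgroup_comp hGamma (svalP f) (svalP g)).
Definition homeo_inv (g : G) : G := sval (cid (homeo_inv_subproof g)).

Lemma homeo_group_inj (f g : G) : sval f = sval g -> f = g.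
Proof. by case: f g => [f Gf] [g Gg] /= fg; apply/eq_exist. Qed.

Lemma homeo_mulA : associative homeo_mul.
Proof. by move=> f g h; apply: homeo_group_inj. Qed.
Lemma homeo_mul1 : left_id homeo_one homeo_mul.
Proof. by move=> f; apply: homeo_group_inj. Qed.
Lemma homeo_mulr1 : right_id homeo_one homeo_mul.
Proof. by move=> f; apply: homeo_group_inj. Qed.
Lemma homeo_mulV : left_inverse homeo_one homeo_inv homeo_mul.
Proof.
move=> f; apply: homeo_group_inj; apply/funext => x /=.
by rewrite /homeo_inv; case: cid => g [/= fg _]; apply: fg.
Qed.
Lemma homeo_mulrV : right_inverse homeo_one homeo_inv homeo_mul.
Proof.
move=> f; apply: homeo_group_inj; apply/funext => x /=.
by rewrite /homeo_inv; case: cid => g [/= _ gf]; apply: gf.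
Qed.

HB.instance Definition _ := gen_eqMixin G.
HB.instance Definition _ := gen_choiceMixin G.
HB.instance Definition _ := isGroup.Build G
  homeo_mulA homeo_mul1 homeo_mulr1 homeo_mulV homeo_mulrV.

Definition real_act (g : G) (r : R) : R := to_real (\val (sval g (of_real r))).

Lemma homeo_lt (g : G) : {homo sval g : x y / \val x < \val y}.
Proof.
by move=> x y xy; have [_ _] := homeo_subgroup_sub hGamma (svalP g); apply.
Qed.

Lemma homeo_interior (g : G) r : 0 < \val (sval g (of_real r)) < 1.
Proof.
have /andP[h0 h1] := of_real_itv r.
have in0 : (0 : R) \in (`[0, 1]%classic : set R) by rewrite inE /= in_itv /= lexx ler01.
have in1 : (1 : R) \in (`[0, 1]%classic : set R) by rewrite inE /= in_itv /= lexx ler01.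
have := @homeo_lt g (SigSub in0) (of_real r) h0.
have := @homeo_lt g (of_real r) (SigSub in1) h1.
have /andP[_ ] := unit_interval_itv (sval g (SigSub in1)).
have /andP[+ _] := unit_interval_itv (sval g (SigSub in0)).
by move=> a b c d; rewrite (le_lt_trans a d) (lt_le_trans c b).
Qed.

Lemma of_real_act (g : G) r : of_real (real_act g r) = sval g (of_real r).
Proof. by apply: val_inj; rewrite to_realK// homeo_interior. Qed.

Lemma real_act1 r : real_act 1%g r = r.
Proof. exact: of_realK. Qed.

Lemma real_actM (g h : G) r : real_act (g * h)%g r = real_act g (real_act h r).
Proof. by rewrite {2}/real_act of_real_act. Qed.

Lemma real_act_mono (g : G) : {homo real_act g : x y / x < y}.
Proof.
move=> x y; rewrite -(lt_of_real x) -(lt_of_real (real_act g x)) !of_real_act.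
exact: homeo_lt.
Qed.

Lemma real_act_fix N : (forall g, Gamma g -> g <> id ->
    (interior_fixed_points g #<= `I_N)%card) ->
  forall (g : G) (s : seq R), g <> 1%g -> sorted <%R s ->
  (forall x, x \in s -> real_act g x = x) -> (size s <= N)%N.
Proof.
move=> hfix g s g1 ss fs; rewrite -card_le_II.
have /hfix h : sval g <> id by move=> e; apply: g1; apply: homeo_group_inj.
apply: card_le_trans (h (svalP g)).
pose f i := of_real (nth 0 s i).
have finj : {in `I_(size s) &, injective f}.
  move=> i j; rewrite !inE /= => si sj /(congr1 (fun x : X => to_real (\val x))).
  rewrite !of_realK => /eqP; rewrite nth_uniq//; first by move=> /eqP.
  exact: lt_sorted_uniq.
apply: card_le_trans (subset_card_le (A := f @` `I_(size s)) _).
  by have := inj_card_eq finj; rewrite card_eq_sym card_eq_le => /andP[].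
move=> _ [i /= si <-]; split; first exact: of_real_itv.
by rewrite -of_real_act fs// mem_nth.
Qed.

Lemma open_interval_itv (a b : R) : 0 < a -> a < b -> b < 1 ->
  open_interval `]a, b[%classic /\ closure `]a, b[%classic `<=` `]0, 1[.
Proof.
move=> a0 ab b1; split.
  split; first exact: interval_open.
    exact: interval_is_interval.
  by exists ((a + b) / 2); rewrite /= in_itv /= !midf_lt.
have /closure_id e : closed `[a, b]%classic by apply: interval_closed.
have : `]a, b[%classic `<=` `[a, b]%classic by apply: subset_itvW.
move=> /closureS; rewrite -e => h x /h; rewrite /= !in_itv /= => /andP[ax xb].
by rewrite (lt_le_trans a0 ax) (le_lt_trans xb b1).
Qed.

Lemma real_act_proximal : (forall J1 J2 : set R,
    open_interval J1 -> open_interval J2 ->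
    closure J1 `<=` `]0, 1[ -> closure J2 `<=` `]0, 1[ ->
    exists2 g : X -> X, Gamma g & g @` (\val @^-1` J1) `<=` \val @^-1` J2) ->
  forall s t p q, s < t -> p < q ->
  exists g : G, s < real_act g p /\ real_act g q < t.
Proof.
move=> htrans s t p q st pq.
pose itv r r' := `]\val (of_real r), \val (of_real r')[%classic.
have ok r r' : r < r' ->
    open_interval (itv r r') /\ closure (itv r r') `<=` `]0, 1[.
  have /andP[r0 _] := of_real_itv r; have /andP[_ r1] := of_real_itv r'.
  by rewrite -lt_of_real => rr; apply: open_interval_itv.
(* The interval is widened so that its open version contains [p] and [q]. *)
have pq' : p - 1 < q + 1 by lra.
have [J1 cJ1] := ok _ _ pq'; have [J2 cJ2] := ok _ _ st.
have [g Gg sub] := htrans _ _ J1 J2 cJ1 cJ2; exists (exist _ g Gg).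
have img r : p - 1 < r < q + 1 -> s < real_act (exist _ g Gg) r < t.
  move=> /andP[pr rq]; rewrite -(lt_of_real s) -(lt_of_real _ t) of_real_act.
  have : (\val @^-1` itv s t) (g (of_real r)).
    apply: sub; exists (of_real r) => //.
    by rewrite /itv /= in_itv /= !lt_of_real pr.
  by rewrite /itv /= in_itv.
split; [have /img/andP[] : p - 1 < p < q + 1|have /img/andP[] : p - 1 < q < q + 1] => //;
  by apply/andP; split; lra.
Qed.

(** For [x] in [i/n, (i+1)/n), monotonicity gives g x < (i+2)/n <= x + 2/n; near the right end the
    bound [g x <= 1] suffices. *)
Lemma normC0_le (g : G) n : (forall r, r < real_act g r) ->
  (forall i, (0 < i)%N -> (i.+1 < n)%N ->
    real_act g (to_real (i%:R / n%:R)) < to_real (i.+1%:R / n%:R)) ->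
  (0 < n)%N -> normC0 (sval g) <= 2 / n%:R.
Proof.
move=> up net n0; have n0' : 0 < n%:R :> R by rewrite ltr0n.
apply: ge_sup.
  by exists `|\val (sval g (of_real 0)) - \val (of_real 0)|; exists (of_real 0).
move=> _ [x _ <-].
have /andP[x0 x1] := unit_interval_itv x.
have /andP[g0 g1] := unit_interval_itv (sval g x).
have xg : \val x <= \val (sval g x).
  (* An interior [v] between [g x] and [x] also covers the endpoints: it would give v < g v < g x <
     v. *)
  rewrite leNgt; apply/negP => /exists_lt_lt[v /andP[gv vx]].
  have v01 : 0 < v < 1 by rewrite (le_lt_trans g0 gv) (lt_le_trans vx x1).
  have := @homeo_lt g (of_real (to_real v)) x.
  rewrite to_realK// => /(_ vx); rewrite -of_real_act => h.
  have := up (to_real v); rewrite -lt_of_real to_realK// => h'.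
  by move: (lt_trans (lt_trans h' h) gv); rewrite ltxx.
rewrite ger0_norm ?subr_ge0// lerBlDl leNgt; apply/negP => far.
have nx0 : 0 <= n%:R * \val x by rewrite mulr_ge0// ltW.
have /andP[] := truncn_itv nx0; set i := Num.truncn _ => ile ilt.
have i2 : i.+2%:R / n%:R <= \val x + 2 / n%:R.
  by rewrite -addn2 natrD mulrDl lerD2r ler_pdivrMr// mulrC.
have i2n : (i.+2 < n)%N.
  rewrite -(ltr_nat R) -(mul1r n%:R) -ltr_pdivrMr//.
  exact: le_lt_trans i2 (lt_le_trans far g1).
have in01 j : (0 < j)%N -> (j < n)%N -> 0 < (j%:R / n%:R : R) < 1.
  move=> j0 jn; rewrite divr_gt0 ?ltr0n//= ltr_pdivrMr// mul1r ltr_nat//.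
have := net i.+1 isT i2n; rewrite -lt_of_real of_real_act to_realK ?in01// => h.
have : \val x < \val (of_real (to_real (i.+1%:R / n%:R))).
  by rewrite to_realK ?in01// ?(ltnW i2n)// ltr_pdivlMr// mulrC.
move=> /(@homeo_lt g)/lt_trans/(_ h)/lt_le_trans/(_ i2).
by move=> /lt_trans/(_ far); rewrite ltxx.
Qed.

End UnitInterval.

Theorem theorem1p2 (R : realType) (N : nat) (hN : (1 <= N)%N)
    (Gamma : set (unit_interval R -> unit_interval R))
    (hGamma : homeo_subgroup Gamma)
    (hfix : forall g : unit_interval R -> unit_interval R,
      Gamma g -> g <> id -> (interior_fixed_points g #<= `I_N)%card)
    (htrans : forall J1 J2 : set R,
      open_interval J1 -> open_interval J2 ->
      closure J1 `<=` `]0, 1[ -> closure J2 `<=` `]0, 1[ ->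
      exists2 g : unit_interval R -> unit_interval R,
        Gamma g & g @` (\val @^-1` J1) `<=` \val @^-1` J2) :
  ~ C0_discrete Gamma.
Proof.
move=> [eps eps0 disc].
pose n := (Num.truncn (2 / eps)).+1.
have neps : 2 / n%:R <= eps.
  rewrite ler_pdivrMr ?ltr0n// mulrC -ler_pdivrMr//; apply/ltW/truncnS_gt.
pose cut i := to_real (i%:R / n%:R : R).
(* The index runs from 1 to [n - 2], so both cuts of each pair are interior. *)
pose L := [seq (cut i, cut i.+1) | i <- iota 1 (n - 2)].
have cutP i : (0 < i)%N -> (i < n)%N -> \val (of_real (cut i)) = i%:R / n%:R.
  move=> i0 il; rewrite to_realK// divr_gt0 ?ltr0n//= ltr_pdivrMr ?ltr0n//.
  by rewrite mul1r ltr_nat.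
have hL p : p \in L -> p.1 < p.2.
  move=> /mapP[i]; rewrite mem_iota => /andP[i0 il] ->.
  rewrite -lt_of_real !cutP//; last 2 first.
  - by lia.
  - by lia.
  by rewrite ltr_pM2r ?invr_gt0 ?ltr0n// ltr_nat.
have [c [up net]] := exists_small_up (real_act1 hGamma) (@real_actM _ _ hGamma)
  (@real_act_mono _ _ hGamma) (real_act_fix hfix) (real_act_proximal hGamma htrans) hL.
have c1 : sval c <> id.
  move=> e; have := up 0; rewrite /real_act e of_realK ltxx; by [].
have := disc _ (svalP c) c1; rewrite ltNge => /negP; apply.
apply: le_trans neps; apply: normC0_le => // i i0 il.
apply: (net (cut i, cut i.+1)); apply/mapP; exists i => //.
by rewrite mem_iota; lia.
Qed.
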